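(* If a topological space $X$ has countable tightness, then each $\infty$-convex subset $\mathcal F\subset SC_p^*(X)$ is weakly discontinuous and has network weight $nw(\mathcal F)\le nw(X)$.
   Context: A function $f:X\to\mathbb R$ is scatteredly continuous if for each non-empty subset $A\subset X$ the restriction $f|A$ has a point of continuity. $SC_p(X)$ is the linear space of all scatteredly continuous real-valued functions on $X$, with the topology of pointwise convergence (inherited from $\mathbb R^X$); $SC_p^*(X)\subset SC_p(X)$ is the linear subspace of bounded scatteredly continuous functions, with the same topology. A subset $B$ of a (real) linear topological space $L$ is bounded if for each neighborhood $U\subset L$ of zero there is $n\in\mathbb N$ with $B\subset nU$. A subset $K$ of $L$ is $\infty$-convex if for each sequence $(x_n)_{n\in\omega}$ in $K$ that is bounded in $L$ and each sequence $(t_n)_{n\in\omega}$ of non-negative reals with $\sum_{n=0}^\infty t_n=1$ the series $\sum_{n=0}^\infty t_nx_n$ converges to a point of $K$. A family $\mathcal F$ of real-valued functions on $X$ is weakly discontinuous if each non-empty subset $A\subset X$ contains a subset $U\subset A$, open and dense in $A$, such that $f|U$ is continuous for every $f\in\mathcal F$. $X$ has countable tightness if for each $A\subset X$ and each $a\in\bar A$ there is an at most countable $B\subset A$ with $a\in\bar B$. The network weight $nw(Y)$ of a space $Y$ is the smallest cardinality of a network of the topology of $Y$ (a network is a family $\mathcal N$ of subsets of $Y$ such that for every open $W\subset Y$ and $y\in W$ there is $N\in\mathcal N$ with $y\in N\subset W$). $\mathcal F$ carries the topology of pointwise convergence.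
   Formalization: Network weight is taken as the maximum of aleph_0 and the smallest cardinality of a network; with the literal minimum the claim fails for X a single point and F=[0,1]. If X has a finite network, the claim proved is that nw(F) is at most countable. *)

(* Defs.v *)
From HB Require Import structures.
From mathcomp Require Import all_boot all_order all_algebra.
From mathcomp Require Import all_classical all_reals all_analysis.
Set Implicit Arguments.
Unset Strict Implicit.
Unset Printing Implicit Defensive.
Import Order.TTheory GRing.Theory Num.Theory.
Import numFieldNormedType.Exports.
Local Open Scope classical_set_scope.
Local Open Scope card_scope.
Local Open Scope ring_scope.

HB.instance Definition _ (X : Type) (R : realType) :=
  GRing.Lmodule.copy {ptws X -> R^o} (X -> R^o).

Section FunctionSpaces.
Context {X : topologicalType} {R : realType}.

Definition scatteredly_continuous (f : X -> R^o) :=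
  forall A : set X, A !=set0 ->
    exists2 a, A a & f x @[x --> within A (nbhs a)] --> f a.

(* SC_p( X ) and SC_p^*( X ), as subsets of R^X with the topology of pointwise
   convergence. *)
Definition SCp : set {ptws X -> R^o} := [set f | scatteredly_continuous f].

Definition SCp_bounded : set {ptws X -> R^o} :=
  [set f | SCp f /\ bounded_fun (f : X -> R^o)].

Definition weakly_discontinuous (F : set {ptws X -> R^o}) :=
  forall A : set X, A !=set0 ->
    exists U : set X,
      [/\ exists2 O, open O & U = A `&` O, A `<=` closure U &
          forall f, F f -> {within U, continuous (f : X -> R^o)}].

End FunctionSpaces.

Section InftyConvex.
Context {R : realType} {E : preTopologicalLmodType R}.

(* [L] stands for a linear subspace of [E] with the inherited topology: the sets
   [U `<=` L] with [within L (nbhs 0) U] are the neighborhoods of 0 in [L]. *)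
Definition bounded_in (L B : set E) :=
  forall U : set E, U `<=` L -> within L (nbhs (0 : E)) U ->
    exists n : nat, B `<=` [set n%:R *: u | u in U].

Definition infty_convex_in (L K : set E) :=
  forall (x : nat -> E) (t : nat -> R),
    (forall n, K (x n)) -> bounded_in L (range x) ->
    (forall n, 0 <= t n) -> series t @ \oo --> (1 : R) ->
    exists2 y, K y & series (fun n => t n *: x n) @ \oo --> y.

End InftyConvex.

Definition countably_tight (X : topologicalType) :=
  forall (A : set X) (a : X), closure A a ->
    exists B : set X, [/\ B `<=` A, countable B & closure B a].

Definition network (Y : topologicalType) (N : set (set Y)) :=
  forall (W : set Y) (y : Y), open W -> W y ->
    exists S, [/\ N S, S y & S `<=` W].

Lemma card_le_min (T : Type) (D : set (set T)) : D !=set0 ->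
  exists A, D A /\ forall B, D B -> A #<= B.
Proof.
move=> [D0 DD0].
have [[A DA A0]|noE] := pselect (exists2 A, D A & A = set0).
  by exists A; split => // B _; rewrite A0; exact: card_ge0.
(* A maximal set of choice functions of D, any two of which differ at every
   member of D, exhausts some member of D. *)
pose P (Z : set (set T -> T)) := forall g h A, Z g -> Z h -> D A ->
  A (g A) /\ (g A = h A -> g = h).
have [|Z [PZ Zmax]] := @Zorn_bigcup _ P.
  move=> C CP Ctot g h A [Z1 CZ1 Z1g] [Z2 CZ2 Z2h] DA.
  have [Z12|Z21] := Ctot _ _ CZ1 CZ2.
    exact: (CP _ CZ2) (Z12 _ Z1g) Z2h DA.
  exact: (CP _ CZ1) Z1g (Z21 _ Z2h) DA.
have [A [DA AZ]] : exists A, D A /\ forall a, A a -> exists2 g, Z g & g A = a.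
  apply: contrapT => nA.
  have {}nA A : exists a, D A -> A a /\ forall g, Z g -> g A <> a.
    have [DA|nDA] := pselect (D A); last first.
      have [x D0x] : D0 !=set0.
        by apply/set0P/eqP => D00; apply: noE; exists D0.
      by exists x => DA; case: (nDA DA).
    apply: contrapT => na; apply: nA; exists A; split => // a Aa.
    apply: contrapT => ng; apply: na; exists a => _; split => // g Zg gAa.
    by apply: ng; exists g.
  have [g0 g0P] := choice nA.
  apply: (Zmax (Z `|` [set g0])).
    split; first by move=> g Zg; left.
    move=> sub; have Zg0 : Z g0 by apply: sub; right.
    by have [_ /(_ _ Zg0)] := g0P _ DD0.
  move=> g h A [Zg|->] [Zh|->] DA.
  - exact: PZ.
  - have [_ /(_ _ Zg) ne] := g0P _ DA.
    by split; [have [] := PZ _ _ _ Zg Zg DA | move=> /ne].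
  - by have [Ag /(_ _ Zh) ne] := g0P _ DA; split => // /esym.
  - by have [] := g0P _ DA.
exists A; split => // B DB.
have cA a : exists g, A a -> Z g /\ g A = a.
  have [Aa|nAa] := pselect (A a); last by exists (fun=> a).
  by have [g Zg gA] := AZ _ Aa; exists g.
have [c cP] := choice cA.
have injcB : {in A &, injective (fun a => c a B)}.
  move=> a b /set_mem Aa /set_mem Ab.
  have [Za ca] := cP _ Aa; have [Zb cb] := cP _ Ab.
  by have [_ cab] := PZ _ _ _ Za Zb DB => /cab E; rewrite -ca -cb E.
rewrite -(card_le_eql (inj_card_eq injcB)); apply: subset_card_le => _ [a Aa <-].
by have [Za _] := cP _ Aa; have [] := PZ _ _ _ Za Za DB.
Qed.

Section NetworkWeight.
Variable Y : topologicalType.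

Definition least_network (N : set (set Y)) :=
  network N /\ forall M : set (set Y), network M -> N #<= M.

Lemma ex_least_network : exists N, least_network N.
Proof.
apply: card_le_min; exists setT => W y oW Wy.
by exists W; split.
Qed.

Definition min_network : set (set Y) := xget set0 least_network.

Lemma min_networkP : least_network min_network.
Proof. exact: xgetPex ex_least_network. Qed.

(* Cardinals are represented by sets, compared with [#<=]. As usual for
   topological cardinal functions, network weight takes infinite values only:
   it is the maximum of aleph_0 and the least cardinality of a network (without
   this, a singleton would have weight 1, while its space of bounded functions,
   the real line, has countable infinite weight). *)
Definition nw : set (set Y + nat) :=
  if `[< finite_set min_network >] then range inr
  else [set inl S | S in min_network].

End NetworkWeight.
Arguments min_network : clear implicits.
Arguments nw : clear implicits.

Lemma nw_finite (Y : topologicalType) :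
  finite_set (min_network Y) -> nw Y #= [set: nat].
Proof.
move=> finN; rewrite /nw asboolT //.
by apply: inj_card_eq; exact: in2W inr_inj.
Qed.

Lemma nw_infinite (Y : topologicalType) :
  infinite_set (min_network Y) -> nw Y #= min_network Y.
Proof.
move=> infN; rewrite /nw asboolF //.
by apply: inj_card_eq; exact: in2W inl_inj.
Qed.

(* Main.v *)
(* A real function f on A fails to be continuous at p exactly when p lies in the
   closure of {x in A | e <= |f x - f p|} for some e > 0 (a "jump").

   If the functions of F had no common point of continuity on some nonempty A,
   countable tightness would provide a countable Q in A such that at each q in Q
   some f_q in F has a jump along Q.  Boundedness and convexity allow one to
   rescale the differences f_q - g, for a fixed g in F, to sup norm at most 1,
   and a convergent series g + sum t_n u_n with weights chosen inductively, each
   so small that the jumps already produced survive, gives by infinite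
   convexity an element of F that jumps along Q at all points of Q,
   contradicting its scattered continuity.  Hence F has a common point of
   continuity on each nonempty set, which makes it weakly discontinuous.

   For the network weight, peel off X transfinitely: A |-> A \ O A, where O A
   is open, meets A, and F is continuous on the trace of O A on A.  The sets
   obtained are closed and form a decreasing well-ordered tower.  If S belongs
   to a network of X, its points in the smallest member of the tower that meets
   S form the set top(S), and every f in F has arbitrarily small oscillation
   around each point x on some top(S) containing x.  Finitely many conditions
   of the form f(top(S)) in (a, b), with a and b rational, thus define a network
   of F, indexed by finite sequences over an infinite set of cardinality
   nw(X). *)
Require Import Defs.
From mathcomp Require Import all_boot all_order all_algebra.
From mathcomp Require Import all_classical all_reals all_analysis.
From mathcomp Require Import ring lra.
Set Implicit Arguments.
Unset Strict Implicit.
Unset Printing Implicit Defensive.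
Import Order.TTheory GRing.Theory Num.Theory.
Import numFieldNormedType.Exports.
Local Open Scope classical_set_scope.
Local Open Scope card_scope.
Local Open Scope ring_scope.

(** * Jumps and common points of continuity *)

Section Jumps.
Context {R : realType} {X : topologicalType}.
Implicit Types (A : set X) (f g : X -> R) (e d : R) (p : X).

Definition jump A f e p := closure [set x | A x /\ e <= `|f x - f p|] p.

Lemma cvg_withinP A f p :
  f x @[x --> within A (nbhs p)] --> f p <-> forall e, 0 < e -> ~ jump A f e p.
Proof.
split=> [fp e e0 fj|fj].
  have /fj : nbhs p [set x | A x -> `|f p - f x| < e].
    by move/cvgrPdist_lt : fp => /(_ _ e0).
  move=> [x [[Ax ex] /(_ Ax)]].
  by rewrite distrC ltNge ex.
apply/cvgrPdist_lt => e e0; apply: contrapT => ne.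
apply: (fj _ e0) => V pV; apply: contrapT => nV; apply: ne.
rewrite nearE /within /=; near=> x => Ax; rewrite distrC ltNge; apply/negP => ex.
by apply: nV; exists x; split => //; near: x.
Unshelve. all: by end_near. Qed.

Lemma jumpS A f e d p : d <= e -> jump A f e p -> jump A f d p.
Proof.
by move=> de; apply: closureS => x [Ax /(le_trans de)].
Qed.

(** Each point counted for [h] is counted for [f] or for [g], and closure commutes with finite
    unions. *)
Lemma jump_split A f g e d p (h : X -> R) :
  (forall x, A x -> `|h x - h p| <= `|f x - f p| + `|g x - g p|) ->
  jump A h (e + d) p -> jump A f e p \/ jump A g d p.
Proof.
move=> hfg hj.
suff : (closure [set x | A x /\ e <= `|f x - f p|] `|`
    closure [set x | A x /\ d <= `|g x - g p|]) p by [].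
rewrite -closureU; move: hj; apply: closureS => x /= [Ax edx].
have [ex|xe] := leP e `|f x - f p|; [by left|right; split=> //].
by have := hfg x Ax; lra.
Qed.

Lemma jump_sub A B f e p : A `<=` B -> jump A f e p -> jump B f e p.
Proof. by move=> AB; apply: closureS => x [/AB]. Qed.

(** The uniform error [d] is paid twice, once at [x] and once at [p]. *)
Lemma jump_near A f g e d p : A p -> (forall x, A x -> `|f x - g x| <= d) ->
  jump A f (e + (d + d)) p -> jump A g e p.
Proof.
move=> Ap fg; apply: closureS => x /= [Ax ex]; split=> //.
have h1 := fg x Ax; have h2 := fg p Ap.
have : `|f x - f p| <= `|f x - g x| + `|g x - g p| + `|g p - f p|.
  have -> : f x - f p = (f x - g x) + (g x - g p) + (g p - f p) by ring.
  by rewrite (le_trans (ler_normD _ _))// lerD2r ler_normD.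
by rewrite (distrC (g p)); lra.
Qed.

End Jumps.

(** The sets constraining finitely many coordinates generate a filter that converges pointwise to
    [f], hence refines its neighborhood filter. *)
Lemma ptws_nbhsP (R : realType) (X : topologicalType) (f : {ptws X -> R^o})
    (U : set {ptws X -> R^o}) :
  nbhs f U -> exists (s : seq X) (e : R), 0 < e /\
    forall h : {ptws X -> R^o},
      (forall p, p \in s -> `|(h p : R) - f p| < e) -> U h.
Proof.
pose B (se : seq X * R) := [set h : {ptws X -> R^o} |
  forall p, p \in se.1 -> `|(h p : R) - f p| < se.2].
pose G := filter_from [set se : seq X * R | 0 < se.2] B.
have FG : Filter G.
  apply: filter_from_filter; first by exists ([::], 1); rewrite /= ltr01.
  move=> [s e] [s' e'] /= e0 e'0; exists (s ++ s', Num.min e e') => /=.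
    by rewrite lt_min e0.
  move=> h hP; split=> p /= ps.
    by have := hP p; rewrite mem_cat ps lt_min => /(_ isT) /andP[].
  by have := hP p; rewrite mem_cat ps orbT lt_min => /(_ isT) /andP[].
have Gf : {ptws, G --> f}.
  apply/pointwise_cvgP => p; apply/cvgrPdist_lt => e e0.
  exists ([:: p], e) => // h /= /(_ p); rewrite mem_head distrC; exact.
move=> /Gf [[s e] /= e0 BU]; exists s, e; split=> // h hs; exact: BU.
Qed.

Lemma countable_range (T : choiceType) (B : set T) :
  countable B -> B !=set0 -> exists s : nat -> T, range s = B.
Proof.
move=> /countable_injP[f finj] [b Bb].
exists (fun n => xget b [set x | B x /\ f x = n]).
apply/seteqP; split=> [_ [n _ <-]|x Bx].
  by case: xgetP => // x -> [].
exists (f x) => //; case: xgetP => [y -> [By fyx]|/(_ x)]; last by case.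
by apply: finj => //; exact: mem_set.
Qed.

(** * Countable sets of jumps, and series that preserve jumps *)

Section CountableReduction.
Context {R : realType} {X : topologicalType}.

(** A closing-off argument: from one point on, the countable sets supplied by tightness are added
    until every point has its jump along the resulting set. *)
Lemma countable_jumps (F : set (X -> R)) (A : set X) :
  countably_tight X -> A !=set0 ->
  (forall a, A a -> exists f e, [/\ F f, 0 < e & jump A f e a]) ->
  exists q : nat -> X, forall k, exists f e,
    [/\ F f, 0 < e & jump (range q) f e (q k)].
Proof.
move=> tight [a0 Aa0] badA.
have /choice[b bP] : forall a, exists b : nat -> X, A a ->
    range b `<=` A /\ exists f e, [/\ F f, 0 < e & jump (range b) f e a].
  move=> a; have [Aa|] := pselect (A a); last by exists (fun=> a).
  have [f [e [Ff e0 /tight[B [BA cB aB]]]]] := badA _ Aa.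
  have B0 : B !=set0 by have [x []] := aB _ filterT; exists x.
  have [b bB] := countable_range cB B0; exists b => _; rewrite bB; split.
    by move=> x /BA[].
  by exists f, e; split=> //; apply: closureS aB => x Bx; split=> //; case: (BA x).
(* Finite words of indices are paths from [a0]; [q] enumerates their endpoints, with [a0] for
   numbers that code no word. *)
pose w := foldl b a0.
pose q n := if unpickle n is Some v then w v else a0.
have qw v : q (pickle v) = w v by rewrite /q pickleK.
have wA v : A (w v).
  elim/last_ind: v => [//|v n Av]; rewrite /w foldl_rcons.
  by have [+ _] := bP _ Av; apply; exists n.
have qE k : exists v, q k = w v.
  by rewrite /q; case: unpickle => [v|]; [exists v|exists [::]].
exists q => k; have [v ->] := qE k.
have [_ [f [e [Ff e0 fe]]]] := bP _ (wA v).
exists f, e; split=> //; apply: jump_sub fe => _ [n _ <-].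
by exists (pickle (rcons v n)) => //; rewrite qw /w foldl_rcons.
Qed.

(** The weights are fixed before the sum [y] is known, since infinite convexity yields [y] only for
    given weights. *)
Lemma jump_series (A : set X) (g : X -> R) (u : nat -> X -> R) (q : nat -> X) :
  (forall k, A (q k)) -> (forall k x, A x -> `|u k x| <= 1) ->
  exists t : nat -> R, [/\ forall k, 0 <= t k,
    forall n, series t n <= 1 &
    forall y : X -> R,
      (forall x, A x ->
        g x + series (fun k => t k * u k x) n @[n --> \oo] --> y x) ->
      forall k, (exists2 e, 0 < e & jump A (u k) e (q k)) ->
        exists2 e, 0 < e & jump A y e (q k)].
Proof.
move=> Aq u1.
(* [eta] bounds the next weight and halves at each step: all later steps
   together perturb by at most [2 * eta], so a jump of [8 * eta] survives. *)
have step (kS : nat * ((X -> R) * R)) : exists te : R * R, 0 < kS.2.2 ->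
    [/\ 0 <= te.1 <= kS.2.2, 0 < te.2 <= kS.2.2 / 2 &
     (exists2 e, 0 < e & jump A (u kS.1) e (q kS.1)) ->
     jump A (fun x => kS.2.1 x + te.1 * u kS.1 x) (te.2 * 8) (q kS.1)].
  case: kS => k [S eta] /=.
  have [eta0|] := ltP 0 eta; last by exists (0, 0).
  (* Weight 0 keeps a jump already present in the partial sum; [e0 / 8] makes it worth 8 times the
     new bound. *)
  have [[e0 e0_gt0 Sj]|nSj] := pselect (exists2 e, 0 < e & jump A S e (q k)).
    exists (0, Num.min (eta / 2) (e0 / 8)) => /= _; split.
    - by rewrite lexx ltW.
    - by rewrite lt_min ge_min lexx !divr_gt0.
    - move=> _; under [X in jump _ X]eq_fun do rewrite mul0r addr0.
      by apply: jumpS Sj; rewrite -ler_pdivlMr// ge_min lexx orbT.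
  (* Here the partial sum does not jump at [q k], so half of the jump [eta * e] of [eta * u k] must
     pass to the new sum. *)
  have [[e e_gt0 uj]|nuj] := pselect (exists2 e, 0 < e & jump A (u k) e (q k)).
    exists (eta, Num.min (eta / 2) (eta * e / 2 / 8)) => /= _; split.
    - by rewrite lexx ltW.
    - by rewrite lt_min ge_min lexx !divr_gt0// mulr_gt0.
    - move=> _.
      suff : jump A (fun x => S x + eta * u k x) (eta * e / 2) (q k).
        by apply: jumpS; rewrite -ler_pdivlMr// ge_min lexx orbT.
      have ScN : ~ jump A S (eta * e / 2) (q k).
        move=> Sj; apply: nSj; exists (eta * e / 2) => //.
        by rewrite divr_gt0// mulr_gt0.
      have : jump A (fun x => eta * u k x) (eta * e / 2 + eta * e / 2) (q k).
        rewrite -splitr; apply: closureS uj => x [Ax ex]; split=> //.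
        by rewrite -mulrBr normrM gtr0_norm// ler_pM2l.
      have tri x : A x -> `|eta * u k x - eta * u k (q k)| <=
          `|S x - S (q k)| + `|S x + eta * u k x - (S (q k) + eta * u k (q k))|.
        move=> _; have -> : eta * u k x - eta * u k (q k) =
            (S x + eta * u k x - (S (q k) + eta * u k (q k))) - (S x - S (q k)).
          by ring.
        by rewrite [leRHS]addrC ler_normB.
      by case/(jump_split tri).
  exists (0, eta / 2) => /= _; split=> //.
  - by rewrite lexx ltW.
  - by rewrite lexx divr_gt0.
have {step}[c cP] := choice step.
pose next k (S : (X -> R) * R) : (X -> R) * R :=
  ((fun x => S.1 x + (c (k, S)).1 * u k x), (c (k, S)).2).
(* Starting at 1 / 2 gives the invariant [series t n <= 1 - eta n * 2], so the total weight is at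
   most 1. *)
pose st := fix st n := if n is k.+1 then next k (st k) else (g, 1 / 2).
pose t k := (c (k, st k)).1.
pose eta k := (st k).2.
have eta_gt0 k : 0 < eta k.
  elim: k => [|k IH]; first by rewrite /eta /= divr_gt0.
  by have [_ /andP[]] := cP (k, st k) IH.
have t_bd k : 0 <= t k <= eta k by have [] := cP (k, st k) (eta_gt0 k).
have eta_half k : eta k.+1 <= eta k / 2.
  by have [_ /andP[]] := cP (k, st k) (eta_gt0 k).
have stE n x : (st n).1 x = g x + series (fun k => t k * u k x) n.
  elim: n => [|n IH]; first by rewrite /series /= big_geq// addr0.
  by rewrite /= IH seriesSr addrA.
exists t; split=> [k|n|y ycvg k uj]; first by case/andP: (t_bd k).
  suff : series t n <= 1 - eta n * 2 by have := eta_gt0 n; lra.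
  elim: n => [|n IH]; first by rewrite /series /= big_geq// /eta /=; lra.
  by rewrite seriesSr; have := eta_half n; have := t_bd n; lra.
(* Each step moves by at most [eta], which is at most twice the drop of [eta]; the bound
   telescopes. *)
have close j m x : A x ->
    `|(st (j + m)%N).1 x - (st j).1 x| <= 2 * eta j - 2 * eta (j + m)%N.
  move=> Ax; elim: m => [|m IH]; first by rewrite addn0 !subrr normr0.
  rewrite addnS; have := eta_half (j + m)%N.
  have /andP[tm0 tm] := t_bd (j + m)%N.
  have : `|t (j + m)%N * u (j + m)%N x| <= t (j + m)%N.
    by rewrite normrM ger0_norm// ler_piMr// u1.
  rewrite [(st _.+1).1 x]/= -/(t _) => tu eh.
  rewrite addrAC (le_trans (ler_normD _ _))//; lra.
have ybd x : A x -> `|(st k.+1).1 x - y x| <= 2 * eta k.+1.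
  move=> Ax; apply/ler_addgt0Pl => e e0.
  have /cvgrPdist_lt/(_ _ e0)[N _ NP] := ycvg _ Ax.
  have : `|y x - (st (k.+1 + N)%N).1 x| < e.
    by rewrite stE; apply: NP; exact: leq_addl.
  move=> yN.
  have := close k.+1 N x Ax; have := eta_gt0 (k.+1 + N)%N.
  have := ler_distD ((st (k.+1 + N)%N).1 x) ((st k.+1).1 x) (y x).
  rewrite (distrC ((st (k.+1 + N)%N).1 x) (y x)).
  by rewrite (distrC ((st k.+1).1 x) ((st (k.+1 + N)%N).1 x)); lra.
(* The jump of size [8 * eta k.+1] loses [2 * eta k.+1] at each of two points. *)
exists (4 * eta k.+1); first by rewrite mulr_gt0.
apply: (jump_near (Aq k) ybd).
have [_ _ /(_ uj)] := cP (k, st k) (eta_gt0 k).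
by apply: jumpS; rewrite /eta /=; lra.
Qed.
End CountableReduction.

(** * Infinite convexity and common points of continuity *)

Section InftyConvexFunctions.
Context {R : realType} {X : topologicalType}.
Local Notation E := {ptws X -> R^o}.
Implicit Types (f g : X -> R) (F : set E).

Lemma SCpP f : scatteredly_continuous (f : X -> R^o) <->
  forall A : set X, A !=set0 ->
    exists2 a, A a & forall e, 0 < e -> ~ jump A f e a.
Proof.
by split=> + A A0 => /(_ A A0)[a Aa /cvg_withinP fa]; exists a => //;
  exact/cvg_withinP.
Qed.

Lemma bounded_funE f :
  bounded_fun (f : X -> R^o) <-> exists M, forall x, `|f x| <= M.
Proof.
split=> [/pinfty_ex_gt0[M _ fM]|[M fM]]; first by exists M => x; exact: fM.
by exists M; split=> [|N MN x _] /=; [exact: num_real|exact: le_trans (ltW MN)].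
Qed.

Lemma SCp_boundedZ (c : R) f :
  SCp_bounded (f : E) -> SCp_bounded ((fun x => c * f x) : E).
Proof.
move=> [fsc /bounded_funE[M fM]]; split; last first.
  by apply/bounded_funE; exists (`|c| * M) => x; rewrite normrM ler_wpM2l.
move=> A A0; have [a Aa fa] := fsc A A0; exists a => //.
exact: cvgZl_tmp.
Qed.

(** A neighborhood of 0 constrains finitely many coordinates only, so one [N] serves them all, and
    dividing by [N] stays in the subspace. *)
Lemma bounded_in_SCp_bounded (x : nat -> E) :
  (forall n, SCp_bounded (x n)) ->
  (forall p, exists M : R, forall n, `|(x n p : R)| <= M) ->
  bounded_in SCp_bounded (range x).
Proof.
move=> xL /choice[M xM] U UL.
rewrite /within /= => /ptws_nbhsP[s [e [e0 sU]]].
have [N N0 MN] : exists2 N : nat,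
    (0 < N)%N & forall p, p \in s -> M p < e * N%:R.
  elim: s {sU} => [|p s [N N0 IH]]; first by exists 1%N.
  exists (maxn N (Num.bound (`|M p| / e))); first by rewrite leq_max N0.
  move=> p'; rewrite inE => /predU1P[->|/IH].
    rewrite -ltr_pdivrMl// mulrC.
    apply: (@le_lt_trans _ _ (`|M p| / e)).
      by rewrite ler_pM2r ?invr_gt0// ler_norm.
    rewrite (lt_le_trans (archi_boundP _))//; first by rewrite divr_ge0// ltW.
    by rewrite ler_nat leq_maxr.
  move=> /lt_le_trans; apply; rewrite ler_pM2l// ler_nat leq_maxl//.
have NR : 0 < N%:R :> R by rewrite ltr0n.
exists N => _ [m _ <-].
exists (fun p => N%:R^-1 * (x m p : R)); last first.
  apply/funext => p; apply: (etrans (mulrA N%:R _ _)).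
  by rewrite divff ?mul1r// gt_eqF.
apply: sU => [p ps|]; last exact: SCp_boundedZ.
rewrite [(0 : E) p]/(0 : R) subr0 normrM gtr0_norm ?invr_gt0//.
by rewrite mulrC ltr_pdivrMr// (le_lt_trans (xM p m))// MN.
Qed.

(** Evaluation at a point is linear and continuous, so the convergent series can be read
    coordinatewise. *)
Lemma infty_convex_series F (x : nat -> E) (t : nat -> R) :
  F `<=` SCp_bounded -> infty_convex_in SCp_bounded F ->
  (forall n, F (x n)) ->
  (forall p, exists M : R, forall n, `|(x n p : R)| <= M) ->
  (forall n, 0 <= t n) -> series t @ \oo --> (1 : R) ->
  exists2 y : X -> R, F y &
    forall p, series (fun n => t n * (x n p : R)) @ \oo --> y p.
Proof.
move=> FL Fcvx Fx xM t0 t1.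
have [y Fy xy] := Fcvx x t Fx
  (bounded_in_SCp_bounded (fun n => FL _ (Fx n)) xM) t0 t1.
exists y => // p; have /pointwise_cvgP/(_ p) := xy.
rewrite (_ : series (fun n => t n * (x n p : R)) =
  (fun g : E => g p) \o series (fun n => t n *: x n)) //.
apply/funext => n /=; rewrite /series /=.
by elim/big_ind2 : _ => // a b c d -> ->.
Qed.

(** Ordinary convexity: with weights [1 - s], [s], 0, 0, ... the partial sums are constant from
    index 2 on. *)
Lemma infty_convex_segment F f g (s : R) :
  F `<=` SCp_bounded -> infty_convex_in SCp_bounded F ->
  F g -> F f -> 0 <= s <= 1 -> F (fun x => g x + s * (f x - g x)).
Proof.
move=> FL Fcvx Fg Ff /andP[s0 s1].
pose x n : E := if n is 0%N then g else f.
pose t n : R := match n with 0%N => 1 - s | 1%N => s | _ => 0 end.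
have tE (v : nat -> R) n :
    series (fun n => t n * v n) n.+2 = (1 - s) * v 0%N + s * v 1%N.
  elim: n => [|n IH]; last by rewrite seriesSr IH /= mul0r addr0.
  by rewrite /series /= big_nat_recr// big_nat1.
have tcvg (v : nat -> R) l : (1 - s) * v 0%N + s * v 1%N = l ->
    series (fun n => t n * v n) @ \oo --> l.
  move=> vl; apply: cvg_near_cst; exists 2%N => // -[|[|n]]//= _.
  by rewrite tE.
have [||||y Fy xy] := @infty_convex_series F x t FL Fcvx.
- by case.
- move=> p; exists (`|f p| + `|g p|); case => [|n] /=.
    by rewrite lerDr.
  by rewrite lerDl.
- by case=> [|[|n]] /=; rewrite ?subr_ge0.
- rewrite (_ : t = fun n => t n * 1); first by apply: tcvg; ring.
  by apply/funext => n; rewrite mulr1.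
rewrite (_ : (fun _ => _) = y)//; apply/funext => p.
apply: (cvg_unique _ _ (xy p)) => //=; apply: tcvg; rewrite /=; ring.
Qed.

(** The constructed [y] in [F] has no jump along [Q] at some [q k]. If some [h - g] jumps there, so
    does [y] by the choice of weights; otherwise a jump of [f] passes to [g] and then to [y]. Both
    cases are contradictory. *)
Lemma infty_convex_common_continuity F (A : set X) :
  countably_tight X -> F `<=` SCp_bounded -> infty_convex_in SCp_bounded F ->
  A !=set0 ->
  exists2 a, A a & forall f e, F f -> 0 < e -> ~ jump A (f : X -> R) e a.
Proof.
move=> tight FL Fcvx A0; apply: contrapT => nA.
have [|q qP] := @countable_jumps R X F A tight A0.
  move=> a Aa; apply: contrapT => na; apply: nA; exists a => // f e Ff e0 fe.
  by apply: na; exists f, e.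
have [g [_ [Fg _ _]]] := qP 0%N.
have Fbd f : F f -> exists M, forall x, `|f x| <= M.
  by move=> /FL[_ /bounded_funE].
pose Q := range q.
have Qq k : Q (q k) by exists k.
have /choice[u uP] k : exists u : X -> R,
    [/\ F (fun x => g x + u x), forall x, `|u x| <= 1 &
      (exists h e, [/\ F h, 0 < e & jump Q (fun x => h x - g x) e (q k)]) ->
      exists2 e, 0 < e & jump Q u e (q k)].
  have [[h [e [Fh e0 he]]]|nh] :=
    pselect (exists h e, [/\ F h, 0 < e & jump Q (fun x => h x - g x) e (q k)]).
  - have [M hM] := Fbd _ Fh; have [M' gM] := Fbd _ Fg.
    (* This denominator is at least 1, so its inverse is a convexity parameter, and it dominates
       [|h x - g x|], which brings the quotient to norm at most 1. *)
    have C1 : 1 <= `|M| + `|M'| + 1 by rewrite lerDr addr_ge0.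
    have C0 : 0 < `|M| + `|M'| + 1 by exact: lt_le_trans C1.
    exists (fun x => (`|M| + `|M'| + 1)^-1 * (h x - g x)); split.
    + apply: infty_convex_segment => //; rewrite invr_ge0 ltW//= invf_le1//.
    + move=> x; rewrite normrM gtr0_norm ?invr_gt0// mulrC ler_pdivrMr// mul1r.
      rewrite (le_trans (ler_normB _ _))//; have := hM x; have := gM x.
      by have := ler_norm M; have := ler_norm M'; lra.
    + move=> _; exists ((`|M| + `|M'| + 1)^-1 * e).
        by rewrite mulr_gt0 ?invr_gt0.
      apply: closureS he => x [Ax ex]; split=> //.
      by rewrite -mulrBr normrM gtr0_norm ?invr_gt0// ler_pM2l ?invr_gt0.
  - exists (fun=> 0); split => //.
    + by under eq_fun do rewrite addr0.
    + by move=> x; rewrite normr0.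
have [|t [t0 t1 tP]] := @jump_series R X Q g u q Qq.
  by move=> k x _; have [] := uP k.
have tcvg : cvgn (series t).
  apply: nondecreasing_is_cvgn.
    by apply: nondecreasing_series => n _ _; exact: t0.
  by exists 1 => _ [n _ <-].
pose T := limn (series t).
have T1 : T <= 1 by apply: limr_le => //; exact: nearW.
(* The leftover mass [1 - T] goes to [g], at index 0, so that the weights sum to 1. *)
pose x n : E := if n is k.+1 then (fun p => g p + u k p) else g.
pose w n : R := if n is k.+1 then t k else 1 - T.
have wE (v : nat -> R) n : series (fun n => w n * v n) n.+1 =
    (1 - T) * v 0%N + series (fun n => t n * v n.+1) n.
  by rewrite /series /= big_nat_recl.
have [||||y Fy xy] := @infty_convex_series F x w FL Fcvx.
- by case=> [|k] //; have [] := uP k.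
- move=> p; exists (`|g p| + 1); case=> [|k] /=; first by rewrite lerDl.
  by rewrite (le_trans (ler_normD _ _))// lerD2l; have [] := uP k.
- by case=> [|k] /=; rewrite ?subr_ge0.
- rewrite -cvg_shiftS.
  rewrite [X in X @ _](_ : _ = fun n => (1 - T) + series t n); last first.
    apply/funext => n /=; have := wE (fun=> 1) n.
    by under eq_fun do rewrite mulr1; rewrite mulr1 => ->;
      under eq_fun do rewrite mulr1.
  suff : (fun n => (1 - T) + series t n) @ \oo --> (1 - T) + T by rewrite subrK.
  by apply: cvgD => //; exact: cvg_cst.
(* The two partial sums differ by [(T - series t n) * g p], which tends to 0. *)
have ycvg p : Q p -> g p + series (fun k => t k * u k p) n @[n --> \oo] --> y p.
  move=> _; rewrite [X in X @ _](_ : _ = fun n =>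
      series (fun n => w n * x n p) n.+1 + (T - series t n) * g p); last first.
    apply/funext => n; rewrite wE /=.
    rewrite (_ : series (fun k => t k * (g p + u k p)) n =
        series t n * g p + series (fun k => t k * u k p) n).
      by ring.
    rewrite /series /= mulr_suml -big_split /=; apply: eq_bigr => i _; ring.
  suff : (fun n => series (fun n => w n * x n p) n.+1 +
      (T - series t n) * g p) @ \oo --> y p + (T - T) * g p.
    by rewrite subrr mul0r addr0.
  apply: cvgD; first by have := xy p; rewrite -cvg_shiftS; exact.
  apply: cvgM; last exact: cvg_cst.
  by apply: cvgB => //; exact: cvg_cst.
have [/SCpP ysc _] := FL _ Fy.
have [_ [k _ <-] yk] := ysc Q (ex_intro _ _ (Qq 0%N)).
have [hk|nhk] :=
  pselect (exists h e, [/\ F h, 0 < e & jump Q (fun x => h x - g x) e (q k)]).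
  have [_ _ /(_ hk) uk] := uP k.
  by have [e e0 /(yk _ e0)] := tP y ycvg k uk.
(* Here all h - g, h in F, are continuous at [q k] along [Q], so all functions
   of F jump there together. *)
have hg h e : F h -> 0 < e -> ~ jump Q (fun x => h x - g x) e (q k).
  by move=> Fh e0 he; apply: nhk; exists h, e.
have [f [e [Ff e0 fe]]] := qP k.
have := @jump_split R X Q (fun x => f x - g x) g (e / 2) (e / 2) (q k) f.
rewrite -splitr => /(_ _ fe)[| |ge].
- move=> z _; rewrite (_ : f z - f _ =
    (f z - g z - (f (q k) - g (q k))) + (g z - g (q k))); last by ring.
  exact: ler_normD.
- by apply: hg => //; rewrite divr_gt0.
have := @jump_split R X Q y (fun x => y x - g x) (e / 2 / 2) (e / 2 / 2)
  (q k) g.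
rewrite -splitr => /(_ _ ge)[| |].
- move=> z _; rewrite (_ : g z - g _ =
    (y z - y (q k)) - (y z - g z - (y (q k) - g (q k)))); last by ring.
  exact: ler_normB.
- by apply: yk; rewrite !divr_gt0.
- by apply: hg => //; rewrite !divr_gt0.
Qed.

End InftyConvexFunctions.

(** * From common points of continuity to weak discontinuity *)

Section WeakDiscontinuity.
Context {R : realType} {X : topologicalType}.
Implicit Type F : set {ptws X -> R^o}.

(** If density fails in [V], the bad points [D] are dense in the trace of [A] on [V]. A common
    continuity point [x] on [D] is then one on [A]: a jump at [x] would lead to a good point [y],
    and a bad point [z] near [y] has a value close to both [f y] and [f x]. *)
Lemma common_continuity_weakly_discontinuous F :
  (forall A : set X, A !=set0 ->
    exists2 a, A a & forall f e, F f -> 0 < e -> ~ jump A (f : X -> R) e a) ->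
  weakly_discontinuous F.
Proof.
move=> common A A0.
pose C := [set a | A a /\ forall f e, F f -> 0 < e -> ~ jump A (f : X -> R) e a].
pose O := \bigcup_(W in [set W | open W /\ A `&` W `<=` C]) W.
exists (A `&` O); split.
- by exists O => //; apply: bigcup_open => W [].
- move=> a Aa B /nbhs_interior aB.
  pose V := B^°.
  have Va : V a by exact: nbhs_singleton.
  have oV : open V by exact: open_interior.
  suff [W [oW WV WC [w [Aw Ww]]]] : exists W,
      [/\ open W, W `<=` V, A `&` W `<=` C & A `&` W !=set0].
    exists w; split; last by apply: interior_subset; exact: WV.
    by split=> //; exists W.
  apply: contrapT => nW.
  have small W : open W -> W `<=` V -> A `&` W !=set0 ->
      exists x, [/\ A x, W x & ~ C x].
    move=> oW WV AW; apply: contrapT => nx; apply: nW; exists W; split=> //.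
    by move=> x [Ax Wx]; apply: contrapT => Cx; apply: nx; exists x.
  pose D := [set x | [/\ A x, V x & ~ C x]].
  have D0 : D !=set0.
    by have [||x] := small V oV; [by []|by exists a|exists x].
  have [x [Ax Vx nCx] xD] := common D D0.
  apply: nCx; split=> // f e Ff e0 fj.
  have [W1 [oW1 W1x] W1D] : exists2 W, open W /\ W x &
      forall y, D y -> W y -> `|(f y : R) - f x| < e / 2.
    have : nbhs x [set y | D y -> `|(f y : R) - f x| < e / 2].
      have /cvg_withinP/cvgrPdist_lt/(_ _ (divr_gt0 e0 (ltr0Sn R 1))) :
          forall e, 0 < e -> ~ jump D (f : X -> R) e x by move=> ? /(xD _ _ Ff).
      by rewrite near_withinE; apply: filterS => y + Dy => /(_ Dy); rewrite distrC.
    by rewrite nbhsE => -[W [oW Wx] WD]; exists W => // y Dy /WD; exact.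
  have [|y [[Ay ey] [W1y Vy]]] := fj (W1 `&` V).
    by apply: open_nbhs_nbhs; split=> //; exact: openI.
  (* Bad points near [x] have values within [e / 2] of [f x], so [y] is not one of them. *)
  have Cy : C y.
    apply: contrapT => nCy; have := W1D y (And3 Ay Vy nCy) W1y.
    by move: ey; rewrite leNgt; lra.
  have [W2 [oW2 W2y] W2A] : exists2 W, open W /\ W y &
      forall z, A z -> W z -> `|(f z : R) - f y| < e / 2.
    have : nbhs y [set z | A z -> `|(f z : R) - f y| < e / 2].
      have /cvg_withinP/cvgrPdist_lt/(_ _ (divr_gt0 e0 (ltr0Sn R 1))) :
          forall e, 0 < e -> ~ jump A (f : X -> R) e y by move=> ? /(Cy.2 _ _ Ff).
      by rewrite near_withinE; apply: filterS => z + Az => /(_ Az); rewrite distrC.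
    by rewrite nbhsE => -[W [oW Wy] WA]; exists W => // z Az /WA; exact.
  have [|||z [Az [[W1z Vz] W2z] nCz]] := small (W1 `&` V `&` W2).
  + by apply: openI => //; exact: openI.
  + by move=> z [[]].
  + by exists y.
  have := W1D z (And3 Az Vz nCz) W1z; have := W2A z Az W2z.
  have := ler_distD (f z : R) (f y) (f x).
  by rewrite (distrC (f y : R) (f z)); lra.
- move=> f Ff; apply/subspace_continuousP => x [Ax [W [oW WC] Wx]].
  have [_ /(_ f)fx] := WC x (conj Ax Wx).
  have /cvg_withinP : forall e, 0 < e -> ~ jump A (f : X -> R) e x.
    by move=> e; exact: fx.
  by apply: cvg_trans; apply: cvg_app; apply: within_subset => y [].
Qed.

End WeakDiscontinuity.

(** * Towers and network weight *)

Section Tower.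
Context {T : Type} (next : set T -> set T).
Hypothesis next_sub : forall A, next A `<=` A.

(** Intersections play the role of limit stages in a transfinite recursion; the empty one
    contributes the whole set. *)
Inductive tower : set T -> Prop :=
| tower_bigcap (G : set (set T)) :
    (forall A, G A -> tower A) -> tower (\bigcap_(A in G) A)
| tower_next A : tower A -> tower (next A).

(** This is more than comparability: no member lies strictly between [next B] and [B]. The induction
    on [A], then on [B], carries the mirror statement along because the successor steps consult both
    halves. *)
Lemma tower_total A B : tower A -> tower B -> A `<=` next B \/ B `<=` A.
Proof.
move=> tA tB; suff [] : (A `<=` next B \/ B `<=` A) /\
  (B `<=` next A \/ A `<=` B) by [].
elim: tA B tB => {A} [G tG IHG|A tA IHA] B tB.
  have half B' : tower B' -> (\bigcap_(A in G) A) `<=` next B' \/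
      B' `<=` \bigcap_(A in G) A.
    move=> tB'; have [[A [GA AB]]|nA] := pselect (exists A, G A /\ A `<=` next B').
      by left=> x /(_ A GA); exact: AB.
    right=> x Bx A GA; have [[AB|BA] _] := IHG A GA B' tB'; last exact: BA.
    by case: nA; exists A.
  elim: tB => {B} [H tH IHH|B tB [_ IHB]]; split; try apply: half => //.
  - exact: tower_bigcap.
  - have [[B [HB BG]]|nB] :=
        pselect (exists B, H B /\ B `<=` next (\bigcap_(A in G) A)).
      by left=> x /(_ B HB); exact: BG.
    right=> x Gx B HB; have [_ [BG|]] := IHH B HB; last exact.
    by case: nB; exists B.
  - exact: tower_next.
  - case: IHB => [BG|GB]; first by left; exact: subset_trans BG.
    have [GB'|BG] := half B tB; first by right.
    left; rewrite (_ : B = \bigcap_(A in G) A)//; exact/seteqP.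
have half B' : tower B' -> next A `<=` next B' \/ B' `<=` next A.
  move=> tB'; have [[AB|BA] [BA'|AB']] := IHA B' tB'; first by right.
  - by left; exact: subset_trans AB.
  - by right.
  - by left; rewrite (_ : A = B') //; exact/seteqP.
elim: tB => {B} [H tH IHH|B tB [_ IHB]]; split; try apply: half => //.
- exact: tower_bigcap.
- have [[B [HB BG]]|nB] := pselect (exists B, H B /\ B `<=` next (next A)).
    by left=> x /(_ B HB); exact: BG.
  right=> x Gx B HB; have [_ [BG|]] := IHH B HB; last exact.
  by case: nB; exists B.
- exact: tower_next.
- case: IHB => [BG|GB]; first by left; exact: subset_trans BG.
  have [GB'|BG] := half B tB; first by right.
  left; rewrite (_ : B = next A)//; exact/seteqP.
Qed.

End Tower.

Lemma weakly_discontinuous_network (R : realType) (X : topologicalType)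
    (F : set {ptws X -> R^o}) (N : set (set X)) :
  weakly_discontinuous F -> network N ->
  exists top : set X -> set X, forall (f : {ptws X -> R^o}) x (e : R),
    F f -> 0 < e ->
    exists S, [/\ N S, top S x & forall y, top S y -> `|(f y : R) - f x| < e].
Proof.
move=> wdF netN.
have /choice[ O OP] : forall A : set X, exists O : set X, [/\ open O,
    A !=set0 -> A `&` O !=set0 &
    forall f, F f -> {within A `&` O, continuous (f : X -> R^o)}].
  move=> A; have [[a Aa]|] := pselect (A !=set0).
    have [U [[ O oO UAO] AU cU]] := wdF A (ex_intro _ _ Aa).
    exists O; rewrite -UAO; split=> // _.
    by have [x [Ux _]] := AU _ Aa _ filterT; exists x.
  by move=> A0; exists set0; split=> // [|f Ff];
    [exact: open0|rewrite setI0; exact: continuous_subspace0].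
pose next (A : set X) := A `\` O A.
have next_sub A : next A `<=` A by exact: subDsetl.
have clT A : tower next A -> closed A.
  elim=> [G _ clG|B _ clB]; first exact: closed_bigI.
  by apply: closedI => //; apply: open_closedC; have [] := OP B.
(* This set is empty when the intersection of all tower members meeting [S] misses [S]. *)
exists (fun S => [set x | S x /\ forall A, tower next A -> A `&` S !=set0 -> A x]).
move=> f x e Ff e0.
(* The least tower member containing [x]. As [next B] is strictly smaller, it omits [x], which
   therefore lies in [O B]. *)
pose B := \bigcap_(A in [set A | tower next A /\ A x]) A.
have tB : tower next B by apply: tower_bigcap => A [].
have Bx : B x by move=> A [].
have [_ BO0 cB] := OP B.
have nBx : ~ next B x.
  move=> nBx; have [|y [By Oy]] := BO0; first by exists x.
  by have [] := By (next B) (conj (tower_next tB) nBx).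
have OBx : O B x by apply: contrapT => nO; apply: nBx.
have /subspace_continuousP/(_ x (conj Bx OBx))/cvgrPdist_lt/(_ e e0) := cB f Ff.
rewrite near_withinE nbhsE => -[W [oW Wx] We].
(* Avoiding [next B] makes [B] the least member meeting [S]: by [tower_total] any other member
   contains [B], or lies in [next B] and misses [S]. *)
have [|//|S [NS Sx SW]] := netN (W `&` ~` next B) x.
  by apply: openI => //; apply: closed_openC; apply: clT; exact: tower_next.
exists S; split=> //.
  split=> // A tA [y [Ay Sy]].
  have [AB|] := tower_total next_sub tA tB; last exact.
  by have [_] := SW y Sy; have := AB y Ay.
move=> y [Sy yS].
have By : B y by apply: yS => //; exists x.
have [Wy nBy] := SW y Sy.
rewrite distrC; apply: We => //; split=> //.
by apply: contrapT => nO; apply: nBy.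
Qed.

(** * Squares and finite sequences over infinite sets *)

Section InfiniteCardinals.

Lemma card_le_injP (T U : Type) (A : set T) (B : set U) :
  A #<= B -> exists f : A -> B, injective f.
Proof.
move=> /card_leP/injfunPex[f _ finj]; exists f => x y.
by apply: finj; rewrite inE.
Qed.

Lemma card_leTTP (T U : Type) :
  [set: T] #<= [set: U] <-> exists f : T -> U, injective f.
Proof.
split=> [/card_le_injP[f finj]|[f finj]].
  exists (fun x => val (f (SigSub (mem_set (I : [set: T] x))))) => x y.
  by move=> /val_inj/finj/(congr1 val).
rewrite -(card_le_eql (@inj_card_eq _ _ setT f _)); first exact: subset_card_le.
by move=> x y _ _ /finj.
Qed.

Lemma card_le_surj (T U : Type) (t : T) (A : set T) (B : set U) :
  A #<= B -> exists k : B -> T, A `<=` range k.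
Proof.
move=> /card_le_injP[f finj].
have /choice[k kP] : forall b : B, exists x, forall a : A, f a = b -> val a = x.
  move=> b; have [[a fab]|na] := pselect (exists a : A, f a = b).
    exists (val a) => a' fa'b; congr val.
    by apply: finj; rewrite fab.
  by exists t => a fab; case: na; exists a.
exists k => a Aa; exists (f (SigSub (mem_set Aa))) => //.
by rewrite -(kP _ _ erefl).
Qed.

Variable T : choiceType.

(** The graph of an injection of [A * A] into [A], kept as a set so that Zorn's lemma applies to
    inclusion. *)
Definition square_graph (Z : set (T * T * T)) (A : set T) :=
  [/\ forall p z, Z (p, z) -> [/\ A p.1, A p.2 & A z],
      forall p, A p.1 -> A p.2 -> exists z, Z (p, z),
      forall p z z', Z (p, z) -> Z (p, z') -> z = z' &
      forall p p' z, Z (p, z) -> Z (p', z) -> p = p'].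

Lemma maximal_square_graph : infinite_set [set: T] ->
  exists Z A, [/\ square_graph Z A, [set: nat] #<= A &
    forall Z' A', square_graph Z' A' -> Z `<=` Z' -> Z' `<=` Z].
Proof.
move=> /infiniteP/card_leTTP[i iinj].
pose A0 := range i.
pose Z0 : set (T * T * T) :=
  [set w | exists m n, w = (i m, i n, i (pickle (m, n)))].
have gZ0 : square_graph Z0 A0.
  split.
  - by move=> _ _ [m [n [-> ->]]]; split; [exists m|exists n|exists (pickle (m, n))].
  - by move=> [x y] /= [m _ <-] [n _ <-]; exists (i (pickle (m, n))), m, n.
  - by move=> _ _ _ [m [n [-> ->]]] [m' [n' [/iinj<- /iinj<- ->]]].
  - move=> _ _ _ [m [n [-> ->]]] [m' [n' [-> /iinj]]].
    by move=> /(pcan_inj pickleK) [-> ->].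
pose P Z := Z = set0 \/ exists2 A, square_graph Z A & Z0 `<=` Z.
have [|Z [[->|[A gZ Z0Z]] Zmax]] := @Zorn_bigcup _ P.
- move=> F FP Ftot; have [[Z1 [FZ1 [w Z1w]]]|nF] :=
      pselect (exists Z, F Z /\ Z !=set0); last first.
    left; apply/seteqP; split=> // w [Z FZ Zw].
    by apply: nF; exists Z; split=> //; exists w.
  right.
  have FA Z v : F Z -> Z v -> exists2 A, square_graph Z A & Z0 `<=` Z.
    by move=> FZ Zv; have [Z00|//] := FP _ FZ; rewrite Z00 in Zv.
  pose B := [set x | exists Z A, [/\ F Z, square_graph Z A & A x]].
  have FU Z : F Z -> Z `<=` \bigcup_(Z in F) Z by move=> FZ v Zv; exists Z.
  have pair v v' : (\bigcup_(Z in F) Z) v -> (\bigcup_(Z in F) Z) v' ->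
      exists Z A, [/\ square_graph Z A, Z v & Z v'].
    move=> [Z FZ Zv] [Z' FZ' Z'v'].
    have [ZZ'|Z'Z] := Ftot _ _ FZ FZ'.
      by have [A gA _] := FA _ _ FZ' Z'v'; exists Z', A; split=> //; exact: ZZ'.
    by have [A gA _] := FA _ _ FZ Zv; exists Z, A; split=> //; exact: Z'Z.
  exists B; last first.
    have [A gA Z01] := FA _ _ FZ1 Z1w.
    exact: subset_trans (FU _ FZ1).
  split.
  - move=> p z [Z FZ Zpz]; have [A gA _] := FA _ _ FZ Zpz.
    by have [/(_ _ _ Zpz)[A1 A2 Az] _ _ _] := gA; split; exists Z, A.
  - move=> p [Z [A [FZ gA Ap1]]] [Z' [A' [FZ' gA' Ap2]]].
    have diag Y C x : square_graph Y C -> C x -> exists z, Y (x, x, z).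
      by move=> [_ + _ _] Cx => /(_ (x, x)); exact.
    have [z1 Zz1] := diag _ _ _ gA Ap1; have [z2 Zz2] := diag _ _ _ gA' Ap2.
    have [ZZ'|Z'Z] := Ftot _ _ FZ FZ'.
      have [/(_ _ _ (ZZ' _ Zz1))[/= A'p1 _ _] /(_ p A'p1 Ap2)[z Zz] _ _] := gA'.
      by exists z; exists Z'.
    have [/(_ _ _ (Z'Z _ Zz2))[/= A'p2 _ _] /(_ p Ap1 A'p2)[z Zz] _ _] := gA.
    by exists z; exists Z.
  - move=> p z z' Zz Zz'; have [Z [A [[_ _ + _] pz pz']]] := pair _ _ Zz Zz'.
    by move=> /(_ _ _ _ pz pz').
  - move=> p p' z Zz Zz'; have [Z [A [[_ _ _ +] pz pz']]] := pair _ _ Zz Zz'.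
    by move=> /(_ _ _ _ pz pz').
- exfalso; apply: (Zmax Z0); last by right; exists A0.
  split=> // /(_ (i 0%N, i 0%N, i (pickle (0%N, 0%N)))); apply.
  by exists 0%N, 0%N.
- exists Z, A; split=> //.
  + have iA n : A (i n).
      have Zn : Z (i n, i n, i (pickle (n, n))) by apply: Z0Z; exists n, n.
      by have [/(_ _ _ Zn)[]] := gZ.
    rewrite -(card_le_eql (@inj_card_eq _ _ setT i _)); last by move=> x y _ _ /iinj.
    by apply: subset_card_le => _ [n _ <-].
  + move=> Z' A' gZ' ZZ'; apply: contrapT => nZ'Z.
    by apply: (Zmax Z'); [split|right; exists A' => //; exact: subset_trans ZZ'].
Qed.

(** Hessenberg's theorem. As [A * A] embeds into [A], an embedding of [T] into [A] is enough. *)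
Lemma infinite_card_square : infinite_set [set: T] ->
  [set: T * T] #<= [set: T].
Proof.
move=> infT; have [Z [A [gZ natA Zmax]]] := maximal_square_graph infT.
have [ZA Zex Zfun Zinj] := gZ.
have /card_le_injP[c cinj] := natA.
pose c' n : T := val (c (SigSub (mem_set (I : [set: nat] n)))).
have c'A n : A (c' n) by exact: set_valP.
(* Two distinct tags: pairing with them puts two disjoint copies of [A] inside [A]. *)
have c'01 : c' 0%N <> c' 1%N.
  by move=> /val_inj/cinj/(congr1 val).
have /choice[f fP] : forall p : T * T, exists z, A p.1 -> A p.2 -> Z (p, z).
  move=> p; have [[A1 A2]|nA] := pselect (A p.1 /\ A p.2).
    by have [z Zz] := Zex p A1 A2; exists z.
  by exists p.1 => A1 A2; case: nA.
have fA x y : A x -> A y -> A (f (x, y)).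
  by move=> Ax Ay; have [] := ZA _ _ (fP (x, y) Ax Ay).
have finj x y x' y' : A x -> A y -> A x' -> A y' ->
    f (x, y) = f (x', y') -> x = x' /\ y = y'.
  move=> Ax Ay Ax' Ay' ff.
  have := fP (x, y) Ax Ay; rewrite ff => /Zinj/(_ (fP (x', y') Ax' Ay')).
  by case.
(* If [~` A] embeds into [A] then so does [T].  Otherwise [A] embeds into
   [~` A], and the graph extends to [A] together with that copy, against its
   maximality. *)
pose e (h : T -> T) x := if `[< A x >] then f (c' 0%N, x) else f (c' 1%N, h x).
have eA (h : T -> T) x : (~ A x -> A (h x)) -> A (e h x).
  by rewrite /e; case: asboolP => Ax hx; apply: fA => //; exact: hx.
have einj (h : T -> T) x y : (~ A x -> A (h x)) -> (~ A y -> A (h y)) ->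
    (~ A x -> ~ A y -> h x = h y -> x = y) -> e h x = e h y -> x = y.
  rewrite /e; case: asboolP => Ax; case: asboolP => Ay hx hy hxy.
  - by move=> /finj[].
  - by move=> /finj[]//; exact: hy.
  - by move=> /finj[]//; [exact: hx|move=> /esym].
  - by move=> /finj[]//; [exact: hx|exact: hy|move=> _; exact: hxy].
(* Comparability of two cardinals, as existence of the smaller one. *)
have [D [DA Dmin]] : exists D, [set A; ~` A] D /\
    forall B, [set A; ~` A] B -> D #<= B.
  by apply: card_le_min; exists A; left.
have [hcAA|hAcA] : (~` A #<= A) \/ (A #<= ~` A).
  by case: DA Dmin => -> Dmin; [right; apply: Dmin; right|left; apply: Dmin; left].
- have /card_le_injP[h' h'inj] := hcAA.
  have /choice[h hP] : forall x, exists y, forall nAx : ~ A x,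
      y = val (h' (SigSub (mem_set (nAx : (~` A) x)))).
    move=> x; have [Ax|nAx] := pselect (A x); first by exists x.
    by exists (val (h' (SigSub (mem_set (nAx : (~` A) x))))) => nAx';
      rewrite (Prop_irrelevance nAx nAx').
  have hA x : ~ A x -> A (h x) by move=> nAx; rewrite (hP _ nAx); exact: set_valP.
  have hinj x y : ~ A x -> ~ A y -> h x = h y -> x = y.
    by move=> nAx nAy; rewrite (hP _ nAx) (hP _ nAy) => /val_inj/h'inj/(congr1 val).
  have hA' x : A (e h x) by apply: eA; exact: hA.
  have he x y : e h x = e h y -> x = y.
    by apply: einj; [exact: hA|exact: hA|exact: hinj].
  apply/card_leTTP; exists (fun p => f (e h p.1, e h p.2)) => -[x y] [x' y'] /=.
  by move=> /finj[]// /he -> /he ->.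
exfalso; have /card_le_injP[h' h'inj] := hAcA.
have /choice[h hP] : forall x, exists y, forall Ax : A x,
    y = val (h' (SigSub (mem_set Ax))).
  move=> x; have [Ax|nAx] := pselect (A x); last by exists x.
  by exists (val (h' (SigSub (mem_set Ax)))) => Ax';
    rewrite (Prop_irrelevance Ax Ax').
have hA x : A x -> ~ A (h x).
  by move=> Ax; rewrite (hP _ Ax); exact: (@set_valP _ (~` A)).
have hinj x y : A x -> A y -> h x = h y -> x = y.
  by move=> Ax Ay; rewrite (hP _ Ax) (hP _ Ay) => /val_inj/h'inj/(congr1 val).
pose C := A `|` h @` A.
have /choice[hi hiP] : forall x, exists y, (h @` A) x -> A y /\ h y = x.
  move=> x; have [[y Ay hyx]|nx] := pselect ((h @` A) x); last by exists x.
  by exists y.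
have CA x : C x -> ~ A x -> A (hi x) by move=> [//|/hiP[]].
have Ce x : C x -> A (e hi x) by move=> Cx; apply: eA; exact: CA.
have Cinj x y : C x -> C y -> e hi x = e hi y -> x = y.
  move=> Cx Cy; apply: einj; [exact: CA|exact: CA|move=> nAx nAy].
  by case: Cx => [//|/hiP[_ {2}<-]]; case: Cy => [//|/hiP[_ {2}<-]] ->.
(* New pairs take values in the copy of [A] under [h], outside [A], so they cannot collide with
   values of [Z]. *)
pose Zn : set (T * T * T) := [set w |
  [/\ C w.1.1, C w.1.2, ~ (A w.1.1 /\ A w.1.2) & w.2 = h (f (e hi w.1.1, e hi w.1.2))]].
have gZ' : square_graph (Z `|` Zn) C.
  split.
  - move=> p z [/ZA[]|[/= C1 C2 _ ->]]; first by split; left.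
    split=> //; right; exists (f (e hi p.1, e hi p.2)) => //.
    by apply: fA; exact: Ce.
  - move=> p C1 C2; have [[A1 A2]|nA] := pselect (A p.1 /\ A p.2).
      by have [z Zz] := Zex p A1 A2; exists z; left.
    by exists (h (f (e hi p.1, e hi p.2))); right.
  - move=> p z z' [Zz|[/= C1 C2 nA ->]] [Zz'|[/= C1' C2' nA' ->]] //.
    + exact: Zfun Zz Zz'.
    + by case: nA'; have [] := ZA _ _ Zz.
    + by case: nA; have [] := ZA _ _ Zz'.
  - move=> p p' z [Zz|[/= C1 C2 nA ->]] [Zz'|[/= C1' C2' nA' zE]].
    + exact: Zinj Zz Zz'.
    + have [_ _] := ZA _ _ Zz; rewrite zE => Ah.
      by case: (hA _ _ Ah); apply: fA; exact: Ce.
    + have [_ _ Ah] := ZA _ _ Zz'.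
      by case: (hA _ _ Ah); apply: fA; exact: Ce.
    + have /finj[||||] : f (e hi p.1, e hi p.2) = f (e hi p'.1, e hi p'.2).
        by apply: hinj => //; apply: fA; exact: Ce.
      1-4: exact: Ce.
      move=> /Cinj e1 /Cinj e2.
      by rewrite (surjective_pairing p) (surjective_pairing p') e1// e2.
have ZZ' : Z `|` Zn `<=` Z by apply: Zmax gZ' _; exact: subsetUl.
pose x := h (c' 0%N).
have nAx : ~ A x by exact: hA.
have Cx : C x by right; exists (c' 0%N).
have /ZZ'/ZA[] : (Z `|` Zn) (x, x, h (f (e hi x, e hi x))) by right; split=> // -[].
by move=> /nAx.
Qed.

(** Iterated pairing is injective among lists of one length; recording the length separates the
    others. *)
Lemma infinite_card_seq : infinite_set [set: T] -> [set: seq T] #<= [set: T].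
Proof.
move=> infT; have /card_leTTP[f finj] := infinite_card_square infT.
have /infiniteP/card_leTTP[i iinj] := infT.
pose enc := foldr (fun x y => f (x, y)) (i 0%N).
apply/card_leTTP; exists (fun s => f (i (size s), enc s)) => s s'.
move=> /finj[/iinj]; elim: s s' => [|x s IH] [|x' s'] //= [ss] /finj[-> es].
by rewrite (IH _ ss es).
Qed.

End InfiniteCardinals.

(** * The network weight of the family *)

Lemma nat_card_le_nw (Y : topologicalType) : [set: nat] #<= nw Y.
Proof.
have [fN|iN] := pselect (finite_set (min_network Y)).
  by rewrite (card_le_eqr (nw_finite fN)).
by rewrite (card_le_eqr (nw_infinite iN)); exact/infiniteP.
Qed.

Lemma min_network_card_le_nw (Y : topologicalType) : min_network Y #<= nw Y.
Proof.
have [fN|iN] := pselect (finite_set (min_network Y)).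
  by rewrite (card_le_eqr (nw_finite fN)); exact: finite_set_countable.
by rewrite (card_le_eqr (nw_infinite iN)).
Qed.

(** The bound on [nat] answers to the floor at aleph_0 in [nw]. *)
Lemma nw_card_le (Y : topologicalType) (M : set (set Y)) T (K : set T) :
  network M -> M #<= K -> [set: nat] #<= K -> nw Y #<= K.
Proof.
move=> netM MK natK; have [fN|iN] := pselect (finite_set (min_network Y)).
  by rewrite (card_le_eql (nw_finite fN)).
rewrite (card_le_eql (nw_infinite iN)); apply: card_le_trans MK.
by have [_] := @min_networkP Y; exact.
Qed.

Lemma weakly_discontinuous_nw (R : realType) (X : topologicalType)
    (F : set {ptws X -> R^o}) :
  weakly_discontinuous F -> nw (set_type F) #<= nw X.
Proof.
move=> wdF; pose N := min_network X.
have netN : network N by have [] := @min_networkP X.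
have [top topP] := weakly_discontinuous_network wdF netN.
(* One infinite index type of cardinality [nw X] codes both network members and rationals. *)
pose W := set_type (nw X).
have WE : [set: W] #= nw X by exact: card_setT.
have infW : infinite_set [set: W].
  by apply/infiniteP; rewrite (card_le_eqr WE); exact: nat_card_le_nw.
have [k Nk] := card_le_surj set0 (@min_network_card_le_nw X).
have [r rsurj] : exists r : W -> rat, [set: rat] `<=` range r.
  apply: (card_le_surj (0 : rat)).
  exact: card_le_trans (countableP _) (nat_card_le_nw X).
pose V (s : seq (W * (W * W))) : set (set_type F) :=
  [set f | forall i, i \in s -> forall y, top (k i.1) y ->
    ratr (r i.2.1) < (val f y : R) < ratr (r i.2.2)].
apply: (@nw_card_le _ (range V)); last exact: nat_card_le_nw.
- move=> U f [U' oU' <-] U'f.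
  have [s [e [e0 sU']]] := ptws_nbhsP (open_nbhs_nbhs (conj oU' U'f)).
  have /choice[i iP] : forall p, exists i : W * (W * W), [/\ top (k i.1) p,
      forall y, top (k i.1) y -> ratr (r i.2.1) < (val f y : R) < ratr (r i.2.2),
      (val f p : R) - e < ratr (r i.2.1) & ratr (r i.2.2) < (val f p : R) + e].
    move=> p; have e2 : 0 < e / 2 by rewrite divr_gt0.
    (* Oscillation below [e / 2] leaves room for rationals at distance between [e / 2] and [e] on
       either side of [f p]. *)
    have [S [NS Sp Sf]] := topP (val f) p (e / 2) (set_valP f) e2.
    have [w _ wS] := Nk _ NS.
    have [|a /[!in_itv]/= /andP[a1 a2]] :=
      @rat_in_itvoo R ((val f p : R) - e) ((val f p : R) - e / 2); first by lra.
    have [|b /[!in_itv]/= /andP[b1 b2]] :=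
      @rat_in_itvoo R ((val f p : R) + e / 2) ((val f p : R) + e); first by lra.
    have [wa _ wAE] := rsurj a I; have [wb _ wbE] := rsurj b I.
    exists (w, (wa, wb)); rewrite /= wS wAE wbE; split=> // y /Sf.
    rewrite ltr_distl => /andP[f1 f2].
    by rewrite (lt_trans a2 f1) (lt_trans f2 b1).
  exists (V (map i s)); split.
  + by exists (map i s).
  + by move=> _ /mapP[p ps ->] y; have [_ + _ _] := iP p; exact.
  + move=> h Vh; apply: sU' => p ps.
    have [tp _ i1 i2] := iP p.
    have /andP[] := Vh (i p) (map_f i ps) p tp.
    move=> h1 h2; rewrite ltr_distl; apply/andP.
    by split; [exact: lt_trans i1 h1|exact: lt_trans h2 i2].
- apply: (card_le_trans (card_image_le _ _)); rewrite -(card_le_eqr WE).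
  (* Two pairings code each triple in [W], so lists of conditions become lists over [W]. *)
  have /card_leTTP[f finj] := infinite_card_square infW.
  apply: card_le_trans (infinite_card_seq infW).
  apply/card_leTTP; exists (map (fun i => f (i.1, f i.2))).
  by apply: inj_map => -[x p] [y q] /finj[-> /finj ->].
Qed.

Theorem theorem1p1 (R : realType) (X : topologicalType)
    (F : set {ptws X -> R^o}) :
  countably_tight X ->
  F `<=` SCp_bounded ->
  infty_convex_in SCp_bounded F ->
  weakly_discontinuous F /\ nw (set_type F) #<= nw X.
Proof.
move=> tight FL Fcvx.
have wdF : weakly_discontinuous F.
  apply: common_continuity_weakly_discontinuous => A.
  exact: infty_convex_common_continuity.
by split=> //; exact: weakly_discontinuous_nw.
Qed.
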